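(* Let $p$ be a prime, $q=p^e$ with $e\ge1$, and let $m$ be a positive integer such that $m\mid e$. Then the projective subline $S=\mathbb P^1(\mathbb F_{p^m})=\mathbb F_{p^m}\cup\{\infty\}\subseteq\mathbb P^1(\mathbb F_q)$ satisfies $S\in\mathcal B_{W_{p^m+1}^{\mathrm{Luc}}}$. In particular, $\mathcal B_{W_{p^m+1}^{\mathrm{Luc}}}\neq\varnothing$.
   Context: For nonnegative integers $i,k$ with base-$p$ expansions $i=\sum_r i_rp^r$, $k=\sum_r k_rp^r$ ($0\le i_r,k_r\le p-1$), write $i\le_p k$ if $i_r\le k_r$ for all $r$. $\mathbb F_q[X,Y]_k$ is the space of homogeneous polynomials of degree $k$ over $\mathbb F_q$. The Lucas subspace is $W_k^{\mathrm{Luc}}=\mathrm{span}_{\mathbb F_q}\{X^{k-i}Y^i:0\le i\le k,\ i\le_p k\}\subseteq\mathbb F_q[X,Y]_k$. $\mathbb P^1(\mathbb F_q)=\mathbb F_q\cup\{\infty\}$. For a $k$-subset $S\subseteq\mathbb P^1(\mathbb F_q)$, $F_S(X,Y)=\prod_{t\in S}(X-tY)$, where the factor for $t=\infty$ is taken to be $Y$. For a subspace $W\subseteq\mathbb F_q[X,Y]_k$, $\mathcal B_W=\{S\subseteq\mathbb P^1(\mathbb F_q): |S|=k,\ F_S\in W\}$. *)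

(* Defs.v *)
From HB Require Import structures.
From mathcomp Require Import all_boot all_order all_algebra.
From mathcomp Require Import mpoly.

Set Implicit Arguments.
Unset Strict Implicit.
Unset Printing Implicit Defensive.

Import GRing.Theory.
Local Open Scope ring_scope.

Definition digit (p i r : nat) : nat := (i %/ p ^ r) %% p.

(* Only the positions r < i are compared, so that the relation is boolean:
   for 1 < p the digits of i at positions r >= i vanish since i < p ^ i.
   See digit_leP for the comparison at all positions. *)
Definition digit_le (p i k : nat) : bool :=
  [forall r : 'I_i, digit p i r <= digit p k r]%N.

Lemma digit_leP p i k : (1 < p)%N ->
  reflect (forall r, digit p i r <= digit p k r)%N (digit_le p i k).
Proof.
move=> p_gt1; apply: (iffP forallP) => [le_ik r | le_ik r]; last exact: le_ik.
have [lt_ri | le_ir] := ltnP r i; first exact: (le_ik (Ordinal lt_ri)).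
by rewrite /digit divn_small ?mod0n // (leq_trans (ltn_expl i p_gt1)) //
           leq_exp2l.
Qed.

(* Homogeneous polynomials of degree k in F[X, Y] are dhomog 2 F k, with
   X = 'X_ord0 and Y = 'X_ord_max. *)
Definition formX (F : fieldType) : {mpoly F[2]} := 'X_(ord0 : 'I_2).
Definition formY (F : fieldType) : {mpoly F[2]} := 'X_(ord_max : 'I_2).
Arguments formX {F}.
Arguments formY {F}.

Lemma monomial_homog (F : fieldType) (k : nat) (i : 'I_k.+1) :
  (formX ^+ (k - i) * formY ^+ i : {mpoly F[2]}) \is k.-homog.
Proof.
have X1 (j : 'I_2) : ('X_j : {mpoly F[2]}) \is 1.-homog
  by rewrite dhomogX /= mdeg1.
have := dhomogM (dhomogMn (k - i) (X1 ord0)) (dhomogMn i (X1 ord_max)).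
by rewrite !mul1n subnK // -ltnS.
Qed.

Definition monomial (F : fieldType) (k : nat) (i : 'I_k.+1) : dhomog 2 F k :=
  DHomog (monomial_homog F i).

Definition lucas_space (F : fieldType) (p k : nat) : {vspace dhomog 2 F k} :=
  <<[seq monomial F i | i : 'I_k.+1 <- enum 'I_k.+1 & digit_le p i k]>>%VS.

(* The projective line over F is option F, with None the point at infinity. *)
Definition lin_factor (F : fieldType) (t : option F) : {mpoly F[2]} :=
  if t is Some a then formX - a *: formY else formY.

Definition set_poly (F : finFieldType) (S : {set option F}) : {mpoly F[2]} :=
  \prod_(t in S) lin_factor t.

(* insub casts set_poly S into the type of degree k forms; it yields None
   exactly when set_poly S is not homogeneous of degree k. *)
Definition blocks (F : finFieldType) (k : nat) (W : {vspace dhomog 2 F k}) :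
    {set {set option F}} :=
  [set S : {set option F} |
     (#|S| == k) && (if insub (set_poly S) is Some f then f \in W else false)].

(* divring_closed contains 1 and is closed under x - y and x / y (with
   x / 0 = 0), which over a field characterizes the subfields. *)
Definition subfield_of_order (F : finFieldType) (n : nat) (K : {set F}) : Prop :=
  divring_closed K /\ #|K| = n.

Definition subline (F : finFieldType) (K : {set F}) : {set option F} :=
  None |: [set Some x | x in K].

(* Main.v *)
Require Import Defs.
From mathcomp Require Import all_boot all_order all_algebra.
From mathcomp Require Import mpoly.
From mathcomp Require Import finfield.

Set Implicit Arguments.
Unset Strict Implicit.
Unset Printing Implicit Defensive.

Import GRing.Theory.
Local Open Scope ring_scope.

(** Every element of a subfield K with n elements satisfies a^n = a, so for
    y != 0 the n elements a y (a in K) are the roots of the monic polynomial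
    T^n - y^(n-1) T.  Taking T = X and y = Y gives
    F_S = Y (X^n - X Y^(n-1)) = X^n Y - X Y^n for the subline S over K.
    When n = p^m with m > 0, both 1 and p^m are below p^m + 1 digit by digit.
    The subfield of order p^m is the set of roots of T^(p^m) - T, which divides
    T^q - T, the product of the T - x over all x in F. *)

(** For [a != 0], multiplication by [a] permutes the nonzero elements of [K]. Comparing their
    product before and after gives [a ^+ (#|K| - 1) = 1]. *)
Lemma expf_subfield_card (F : finFieldType) (K : {set F}) (a : F) :
  divring_closed K -> a \in K -> a ^+ #|K| = a.
Proof.
move=> [K1 KB KV] Ka.
have K0 : 0 \in K by rewrite -(subrr 1) KB.
have cardK : #|K| = #|K :\ 0|.+1 by rewrite (cardsD1 0) K0.
have [-> | a0] := eqVneq a 0; first by rewrite cardK expr0n.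
have KM x : (a * x \in K) = (x \in K).
  have KM2 u v : u \in K -> v \in K -> u * v \in K.
    by move=> Ku Kv; rewrite -[v]invrK KV // -[v^-1]mul1r KV.
  apply/idP/idP => [Kax | ]; last exact: KM2.
  by rewrite -(mulKf a0 x) mulrC KV.
have prod0 : \prod_(x in K :\ 0) x != 0.
  by apply/prodf_neq0 => x; rewrite !inE => /andP[].
have: \prod_(x in K :\ 0) x = a ^+ #|K :\ 0| * \prod_(x in K :\ 0) x.
  rewrite [LHS](reindex_inj (mulfI a0)) /=.
  rewrite (eq_bigl (mem (K :\ 0))) => [|x]; last first.
    by rewrite !inE mulf_eq0 (negPf a0) KM.
  by rewrite big_split prodr_const.
rewrite -[LHS]mul1r => /(mulIf prod0) a1.
by rewrite cardK exprS -a1 mulr1.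
Qed.

(** The target is a general domain so that [R] can be the ring of forms, [iota] the embedding of
    constants, and [x], [y] the two variables. *)
Lemma prod_sub_subfield (F : finFieldType) (K : {set F}) (R : idomainType)
    (iota : {rmorphism F -> R}) (x y : R) :
  divring_closed K -> y != 0 ->
  \prod_(a in K) (x - iota a * y) = x ^+ #|K| - x * y ^+ #|K|.-1.
Proof.
move=> /[dup] divK [K1 KB _] y0.
have K0 : 0 \in K by rewrite -(subrr 1) KB.
have n_gt1 : (1 < #|K|)%N.
  by rewrite (cardsD1 0) K0 (cardsD1 1) !inE oner_neq0 K1.
have prodE : \prod_(a in K) ('X - (iota a * y)%:P)
           = \prod_(a <- enum K) ('X - (iota a * y)%:P) by rewrite big_enum.
have {}prodE : \prod_(a in K) ('X - (iota a * y)%:P)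
             = 'X^#|K| - y ^+ #|K|.-1 *: 'X :> {poly R}.
  (* The difference of the two sides vanishes at the [#|K|] distinct points [iota a * y] and has
     degree below [#|K|], so it is zero. *)
  apply/eqP; rewrite -subr_eq0; apply/eqP.
  apply: (@roots_geq_poly_eq0 _ _ [seq iota a * y | a <- enum K]).
  - apply/allP => _ /mapP[a + ->]; rewrite mem_enum => Ka.
    rewrite rootE !hornerE horner_prod (bigD1 a) //= !hornerE subrr mul0r sub0r.
    rewrite exprMn -rmorphXn expf_subfield_card //.
    by rewrite mulrAC -exprSr prednK ?(ltnW n_gt1) // mulrC subrr oppr0.
  - by rewrite map_inj_uniq ?enum_uniq // => a b /(mulIf y0)/fmorph_inj.
  (* Both sides are monic of degree [#|K|], so the top coefficients cancel; [n_gt1] keeps the linear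
     term below that degree. *)
  - rewrite size_map -cardE; apply/leq_sizeP => j le_nj.
    rewrite !coefB coefZ coefXn coefX.
    rewrite [j == 1%N]gtn_eqF ?(leq_trans n_gt1) // mulr0 subr0.
    have szP : size (\prod_(a in K) ('X - (iota a * y)%:P) : {poly R}) = #|K|.+1.
      by rewrite prodE size_prod_XsubC -cardE.
    have [-> | neq_jn] := eqVneq j #|K|; last first.
      by rewrite nth_default ?subr0 // szP ltn_neqAle eq_sym neq_jn.
    have /monicP := monic_prod_XsubC (enum K) xpredT (fun a => iota a * y).
    by rewrite -prodE lead_coefE szP => ->; rewrite subrr.
have := congr1 (horner^~ x) prodE; rewrite horner_prod !hornerE mulrC.
by move=> <-; apply: eq_bigr => a _; rewrite !hornerE.
Qed.

Lemma exprBn_pcharnat (R : comNzRingType) (x y : R) (n : nat) :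
  [char R].-nat n -> (x - y) ^+ n = x ^+ n - y ^+ n.
Proof. by move=> n_pchar; rewrite exprDn_pchar // exprNn_pchar. Qed.

(** Induction on [d]: as [n] is a power of the characteristic, raising ['X^(n ^ d) - 'X] to the
    power [n] gives ['X^(n ^ d.+1) - 'X^n]. *)
Lemma XnsubX_dvdp_iter (F : fieldType) (n d : nat) :
  [char F].-nat n -> 'X^n - 'X %| ('X^(n ^ d) - 'X : {poly F}).
Proof.
move=> n_pchar.
have Pn : [char {poly F}].-nat n by rewrite (eq_pnat _ (@pchar_poly F)).
elim: d => [|d IHd]; first by rewrite expn0 subrr dvdp0.
have -> : 'X^(n ^ d.+1) - 'X = ('X^(n ^ d) - 'X) ^+ n + ('X^n - 'X) :> {poly F}.
  by rewrite exprBn_pcharnat // subrKA -exprM -expnSr.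
by apply: dvdp_add => //; apply: dvdp_exp => //; case/andP: n_pchar.
Qed.

Lemma subfield_of_order_exists (F : finFieldType) (p m d : nat) :
  prime p -> (0 < m)%N -> #|F| = ((p ^ m) ^ d)%N ->
  exists K : {set F}, subfield_of_order (p ^ m) K.
Proof.
move=> p_prime m_gt0 cardF; set n := (p ^ m)%N in cardF *.
have pF : p \in [char F].
  by apply: (@card_finPcharP _ _ (m * d)); rewrite // expnM.
have n_pchar : [char F].-nat n.
  by rewrite pnatX pnatE // pF.
have n_gt1 : (1 < n)%N by rewrite -(exp1n m) ltn_exp2r // prime_gt1.
exists [set x | x ^+ n == x]; split.
  split=> [|x y|x y]; rewrite !inE ?expr1n // => /eqP xn /eqP yn.
    by rewrite exprBn_pcharnat // xn yn.
  by rewrite expr_div_n xn yn.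
have XnX : root ('X^n - 'X : {poly F}) =1 [pred x | x ^+ n == x].
  by move=> x; rewrite rootE !hornerE subr_eq0.
have sz : size ('X^n - 'X : {poly F}) = n.+1.
  by rewrite size_polyDl ?size_polyXn // size_polyN size_polyX.
have := XnsubX_dvdp_iter d n_pchar; rewrite -cardF finField_genPoly.
(* A divisor of a product of distinct linear factors is, up to a unit, the subproduct selected by a
   mask [b]; its degree [n] therefore counts its roots. *)
case/dvdp_prod_XsubC => b eqXb.
rewrite -[RHS]/n.+1.-1 -sz (eqp_size eqXb) size_prod_XsubC /=.
rewrite -(card_uniqP _) ?mask_uniq ?index_enum_uniq //.
apply: eq_card => x; rewrite inE -[RHS](root_prod_XsubC _ x).
by rewrite -(eqp_root eqXb) XnX.
Qed.

Lemma set_poly_subline (F : finFieldType) (K : {set F}) :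
  divring_closed K ->
  set_poly (subline K) = formX ^+ #|K| * formY - formX * formY ^+ #|K|.
Proof.
move=> /[dup] divK [K1 _ _].
have n_gt0 : (0 < #|K|)%N by apply/card_gt0P; exists 1.
have Y0 : formY != 0 :> {mpoly F[2]} by rewrite -msupp_eq0 msuppX.
rewrite /set_poly /subline big_setU1 /=; last by apply/imsetP => -[].
rewrite big_imset /=; last by move=> a b _ _ [].
under eq_bigr do rewrite -mul_mpolyC.
rewrite (prod_sub_subfield (@mpolyC 2 F)) // mulrBr mulrCA -exprS prednK //.
by rewrite mulrC.
Qed.

Lemma digit_le_1_pm1 (p m : nat) :
  (1 < p)%N -> (0 < m)%N -> digit_le p 1 (p ^ m + 1).
Proof.
move=> p_gt1 m_gt0; apply/forallP => r; rewrite ord1 /digit expn0 !divn1.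
by rewrite -modnDml -(prednK m_gt0) expnS modnMr.
Qed.

(** The only nonzero digit of [p ^ m] is a 1 at position [m], and adding 1 causes no carry into that
    position since [1 < p ^ m]. *)
Lemma digit_le_pm_pm1 (p m : nat) :
  (1 < p)%N -> (0 < m)%N -> digit_le p (p ^ m) (p ^ m + 1).
Proof.
move=> p_gt1 m_gt0; apply/(digit_leP _ _ p_gt1) => r; rewrite /digit.
have p_gt0 := ltnW p_gt1.
have [lt_rm | lt_mr | ->] := ltngtP r m.
- rewrite -expnB ?(ltnW lt_rm) //.
  by rewrite -(prednK (n := m - r)) ?subn_gt0 // expnS modnMr.
- by rewrite divn_small ?mod0n // ltn_exp2l.
- rewrite divnDl // divnn expn_gt0 p_gt0 divn_small //.
  by rewrite -(exp1n m) ltn_exp2r.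
Qed.

Lemma subline_in_blocks (F : finFieldType) (p m : nat) (K : {set F}) :
  (1 < p)%N -> (0 < m)%N -> subfield_of_order (p ^ m) K ->
  subline K \in blocks (lucas_space F p (p ^ m + 1)).
Proof.
move=> p_gt1 m_gt0 [divK cardK]; set k := (p ^ m + 1)%N.
have lt_1k : (1 < k.+1)%N by rewrite /k addn1.
have lt_nk : (p ^ m < k.+1)%N by rewrite /k addn1 ltnW.
have Lmon (i : 'I_k.+1) : digit_le p i k -> monomial F i \in lucas_space F p k.
  move=> le_ik; apply: memv_span; apply: map_f.
  by rewrite mem_filter le_ik mem_enum.
(* The indices 1 and [p ^ m] give the two terms of the subline form. Exhibiting it as [val f] makes
   the [insub] in [blocks] succeed. *)
pose f := monomial F (Ordinal lt_1k) - monomial F (Ordinal lt_nk).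
have fE : set_poly (subline K) = val f.
  by rewrite set_poly_subline // cardK /f raddfB /= /k addnK addKn.
rewrite inE fE valK; apply/andP; split.
  rewrite /subline cardsU1 card_imset; last by move=> a b [].
  by rewrite cardK addnC; case: imsetP => [[] |].
by rewrite memvB // Lmon ?digit_le_1_pm1 ?digit_le_pm_pm1.
Qed.

Theorem proposition10 (F : finFieldType) (p e m : nat)
    (p_prime : prime p) (e_gt0 : (1 <= e)%N) (cardF : #|F| = (p ^ e)%N)
    (m_gt0 : (0 < m)%N) (m_dvd_e : (m %| e)%N) :
  [/\ exists K : {set F}, subfield_of_order (p ^ m) K,
      forall K : {set F}, subfield_of_order (p ^ m) K ->
        subline K \in blocks (lucas_space F p (p ^ m + 1))
    & blocks (lucas_space F p (p ^ m + 1)) <> set0].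
Proof.
have p_gt1 := prime_gt1 p_prime.
have exK : exists K : {set F}, subfield_of_order (p ^ m) K.
  (* Divisibility of [e] by [m] makes [#|F|] a power of [p ^ m]. *)
  apply: (@subfield_of_order_exists F p m (e %/ m)) => //.
  by rewrite -expnM mulnC divnK.
split=> // [K|]; first exact: subline_in_blocks.
case: exK => K /(subline_in_blocks p_gt1 m_gt0) + B0.
by rewrite B0 inE.
Qed.
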